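(* Consider a single-armed bandit with subsidy (an arm with $K$ internal states, transition matrix $\mathbf{P}$, reward vector $B$, discount factor $\beta\in(0,1)$, subsidy $m\in\mathbb{R}$, as in the context). Let $\Pi^*_{sa}(m)$ denote the set of all optimal single-arm policies achieving $V_{\beta,m}(\omega)$ with initial belief state $\omega$, and define the passive time $$D_{\beta,m}(\omega):=\max_{\pi\in\Pi^*_{sa}(m)}\mathbb{E}_{\pi}\Big[\sum_{t=1}^{\infty}\beta^{t-1}\mathbf{1}(u(t)=0)\,\Big|\,\omega(1)=\omega\Big].$$ Then the right derivative of the value function $V_{\beta,m}(\omega)$ with respect to $m$, denoted by $\frac{dV_{\beta,m}(\omega)}{(dm)^+}$, exists at every value of $m$, and $$\left.\frac{dV_{\beta,m}(\omega)}{(dm)^+}\right|_{m=m_0}=D_{\beta,m_0}(\omega).$$ Furthermore, the single-armed bandit is indexable if and only if the following holds: for all values of $\omega$ and $m_\omega$ such that $\omega\in C(m_\omega)$, $$\left.\frac{dV_{\beta,m}(\omega;u=0)}{(dm)^+}\right|_{m=m_{\omega}} \ge \left.\frac{dV_{\beta,m}(\omega;u=1)}{(dm)^+}\right|_{m=m_{\omega}},$$ and for any $\omega\in C(m_\omega)$ for which equality holds in this inequality, there exists a $\Delta m(\omega)>0$ such that $$V_{\beta,m}(\omega;u=0)\ge V_{\beta,m}(\omega;u=1)\quad\text{for all } m\in (m_{\omega},\,m_\omega+\Delta m(\omega)).$$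
   Context: The arm is a Markov chain with state space $\{0,1,\dots,K-1\}$, transition matrix $\mathbf{P}=(p_{i,j})$ (assumed irreducible and aperiodic) and reward (row) vector $B=[B_0,\dots,B_{K-1}]$ with $0=B_0\le B_1\le\cdots\le B_{K-1}$. Write $p_k=[p_{k,0},\dots,p_{k,K-1}]$ for the $k$-th row of $\mathbf{P}$, and $'$ for transpose. Belief states are probability row vectors $\omega=(\omega_0,\dots,\omega_{K-1})$ on the internal states; the set of all of them is the simplex $\mathbb{X}$. At each time $t=1,2,\dots$ a binary action $u(t)\in\{0,1\}$ is chosen ($1$ = active, $0$ = passive) by a policy that maps the current belief state $\omega(t)$ to an action (the map may depend on $t$). If $u(t)=1$, the internal state $S(t)$, distributed according to $\omega(t)$, is observed, reward $B_{S(t)}$ is received, and $\omega(t+1)=p_{S(t)}$. If $u(t)=0$, the subsidy $m$ is received, nothing is observed, and $\omega(t+1)=\mathcal{T}^1(\omega(t))$ where $\mathcal{T}^1(\omega)=\omega\mathbf{P}$. The value function $V_{\beta,m}(\omega)$ is the maximum over policies of the expected total discounted reward $\mathbb{E}[\sum_{t\ge1}\beta^{t-1}(\mathbf{1}(u(t)=1)B_{S(t)}+m\,\mathbf{1}(u(t)=0))\mid\omega(1)=\omega]$; it satisfies $V_{\beta,m}(\omega)=\max\{V_{\beta,m}(\omega;u=1),V_{\beta,m}(\omega;u=0)\}$ with $$V_{\beta,m}(\omega;u=1)=\omega B'+\beta\sum_{k=0}^{K-1}\omega_kV_{\beta,m}(p_k),\qquad V_{\beta,m}(\omega;u=0)=m+\beta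 V_{\beta,m}(\mathcal{T}^1(\omega)).$$ The passive set is $P(m)=\{\omega\in\mathbb{X}: V_{\beta,m}(\omega;u=1)\le V_{\beta,m}(\omega;u=0)\}$ and the decision boundary is $C(m)=\{\omega\in\mathbb{X}: V_{\beta,m}(\omega;u=1)=V_{\beta,m}(\omega;u=0)\}$. The single-armed bandit is indexable if $P(m)$ increases monotonically (with respect to inclusion) from $\emptyset$ to the whole space $\mathbb{X}$ as $m$ increases from $-\infty$ to $+\infty$. *)

(* Defs.v *)
From HB Require Import structures.
From mathcomp Require Import all_boot all_order all_algebra.
From mathcomp Require Import all_classical all_reals all_analysis.
Set Implicit Arguments.
Unset Strict Implicit.
Unset Printing Implicit Defensive.
Import Order.TTheory GRing.Theory Num.Theory.
Import numFieldNormedType.Exports.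
Local Open Scope classical_set_scope.
Local Open Scope ring_scope.

Definition simplex (R : realType) (K : nat) : set 'rV[R]_K :=
  [set w | (forall k, 0 <= w 0 k) /\ \sum_k w 0 k = 1].

Definition stochastic (R : realType) (K : nat) (P : 'M[R]_K) : Prop :=
  forall k, simplex (row k P).

Definition irreducible (R : realType) (K : nat) (P : 'M[R]_K) : Prop :=
  forall i j, exists n : nat, 0 < (P ^+ n) i j.

(* The period of every state, i.e. the gcd of its possible return times,
   is 1. *)
Definition aperiodic (R : realType) (K : nat) (P : 'M[R]_K) : Prop :=
  forall (i : 'I_K) (d : nat),
    (forall n : nat, (0 < n)%N -> 0 < (P ^+ n) i i -> (d %| n)%N) -> d = 1%N.

(* Times are numbered from 0, so that time t here is time t + 1 in the usual
   numbering and the discount factor at time t is beta ^+ t.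
   [pi t w = true] means that the arm is activated at time t in belief w.
   A policy is only ever evaluated at the beliefs reachable from the initial
   one, so its values outside the simplex are irrelevant. *)
Definition policy (R : realType) (K : nat) : Type := nat -> 'rV[R]_K -> bool.

(* Probability that the internal states at times 0, 1, ... are the entries of s,
   when the initial state has law w: w_{s_0} p_{s_0,s_1} p_{s_1,s_2} ... *)
Fixpoint path_prob (R : realType) (K : nat) (P : 'M[R]_K)
    (w : 'rV[R]_K) (s : seq 'I_K) : R :=
  if s is k :: s' then w 0 k * path_prob P (row k P) s' else 1.

Definition expect (R : realType) (K : nat) (P : 'M[R]_K) (w : 'rV[R]_K)
    (n : nat) (F : n.-tuple 'I_K -> R) : R :=
  \sum_(s : n.-tuple 'I_K) path_prob P w s * F s.

(* Belief reached from the belief w held at time t, when the internal states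
   visited from time t on are the entries of s; a state is only used when the
   policy observes it. *)
Fixpoint belief_from (R : realType) (K : nat) (P : 'M[R]_K) (pi : policy R K)
    (t : nat) (w : 'rV[R]_K) (s : seq 'I_K) : 'rV[R]_K :=
  if s is k :: s' then
    belief_from P pi t.+1 (if pi t w then row k P else w *m P) s'
  else w.

(* The tuple s lists S(0), ..., S(t); the action u(t) depends only on the
   first t of these states. *)
Definition action (R : realType) (K : nat) (P : 'M[R]_K) (pi : policy R K)
    (w : 'rV[R]_K) (t : nat) (s : t.+1.-tuple 'I_K) : bool :=
  pi t (belief_from P pi 0 w (take t s)).

Definition reward (R : realType) (K : nat) (P : 'M[R]_K) (B : 'rV[R]_K)
    (pi : policy R K) (w : 'rV[R]_K) (m : R) (t : nat)
    (s : t.+1.-tuple 'I_K) : R :=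
  if action P pi w s then B 0 (tnth s ord_max) else m.

(* Expected total discounted value of a quantity F t that depends on the states
   visited up to time t. All the quantities used below are bounded uniformly
   in t and 0 < beta < 1, so that the expectation of the infinite discounted
   sum is the sum of the expectations. *)
Definition discounted (R : realType) (K : nat) (P : 'M[R]_K) (beta : R)
    (w : 'rV[R]_K) (F : forall t : nat, t.+1.-tuple 'I_K -> R) : R :=
  limn (series (fun t : nat => beta ^+ t * expect P w (F t))).

Definition total_reward (R : realType) (K : nat) (P : 'M[R]_K) (B : 'rV[R]_K)
    (beta : R) (w : 'rV[R]_K) (m : R) (pi : policy R K) : R :=
  discounted P beta w (fun t => @reward R K P B pi w m t).

Definition passive_time (R : realType) (K : nat) (P : 'M[R]_K) (beta : R)
    (w : 'rV[R]_K) (pi : policy R K) : R :=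
  discounted P beta w (fun t s => (~~ @action R K P pi w t s)%:R).

Definition value (R : realType) (K : nat) (P : 'M[R]_K) (B : 'rV[R]_K)
    (beta : R) (w : 'rV[R]_K) (m : R) : R :=
  sup (range (total_reward P B beta w m)).

Definition value_active (R : realType) (K : nat) (P : 'M[R]_K) (B : 'rV[R]_K)
    (beta : R) (w : 'rV[R]_K) (m : R) : R :=
  (w *m B^T) 0 0 + beta * \sum_k w 0 k * value P B beta (row k P) m.

Definition value_passive (R : realType) (K : nat) (P : 'M[R]_K) (B : 'rV[R]_K)
    (beta : R) (w : 'rV[R]_K) (m : R) : R :=
  m + beta * value P B beta (w *m P) m.

Definition optimal_policies (R : realType) (K : nat) (P : 'M[R]_K)
    (B : 'rV[R]_K) (beta : R) (w : 'rV[R]_K) (m : R) : set (policy R K) :=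
  [set pi | total_reward P B beta w m pi = value P B beta w m].

Definition optimal_passive_times (R : realType) (K : nat) (P : 'M[R]_K)
    (B : 'rV[R]_K) (beta : R) (w : 'rV[R]_K) (m : R) : set R :=
  passive_time P beta w @` optimal_policies P B beta w m.

Definition max_passive_time (R : realType) (K : nat) (P : 'M[R]_K)
    (B : 'rV[R]_K) (beta : R) (w : 'rV[R]_K) (m : R) : R :=
  sup (optimal_passive_times P B beta w m).

Definition passive_set (R : realType) (K : nat) (P : 'M[R]_K) (B : 'rV[R]_K)
    (beta m : R) : set 'rV[R]_K :=
  [set w | simplex w /\ value_active P B beta w m <= value_passive P B beta w m].

Definition decision_boundary (R : realType) (K : nat) (P : 'M[R]_K)
    (B : 'rV[R]_K) (beta m : R) : set 'rV[R]_K :=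
  [set w | simplex w /\ value_active P B beta w m = value_passive P B beta w m].

Definition indexable (R : realType) (K : nat) (P : 'M[R]_K) (B : 'rV[R]_K)
    (beta : R) : Prop :=
  [/\ forall m1 m2 : R, m1 <= m2 ->
        passive_set P B beta m1 `<=` passive_set P B beta m2,
      \forall m \near -oo, passive_set P B beta m = set0 &
      \forall m \near +oo, passive_set P B beta m = @simplex R K].

Definition right_quotient (R : realType) (f : R -> R) (x h : R) : R :=
  h^-1 * (f (x + h) - f x).

Definition right_derivable (R : realType) (f : R -> R) (x : R) : Prop :=
  cvg (right_quotient f x h @[h --> 0^'+]).

Definition right_derivative (R : realType) (f : R -> R) (x : R) : R :=
  lim (right_quotient f x h @[h --> 0^'+]).

(* Main.v *)
(* For a fixed policy the total reward is an affine function of m whose slope is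
   the passive time. The value function W is at most its Bellman update, so a
   stationary policy that is greedy for W earns at least W by contraction, which
   gives Bellman's equation and optimal policies for every m. Being a maximum of
   affine functions with slopes bounded by 1 / (1 - beta), the value is convex and
   Lipschitz in m, hence right differentiable, and every optimal passive time is
   at most the right derivative. Differentiating Bellman's maximum from the right
   shows that the policy that breaks ties between optimal actions by their right
   derivatives has a passive time equal to the right derivative of the value.
   For fixed w, the gap V(w; u=0) - V(w; u=1) is Lipschitz in m, negative near
   -oo and nonnegative near +oo; indexability says that it stays nonnegative, and
   this can only fail at a zero, where its right derivative decides. *)
Require Import Defs.
From HB Require Import structures.
From mathcomp Require Import all_boot all_order all_algebra.
From mathcomp Require Import all_classical all_reals all_analysis.
From mathcomp Require Import ring lra.
Set Implicit Arguments.
Unset Strict Implicit.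
Unset Printing Implicit Defensive.
Import Order.TTheory GRing.Theory Num.Theory.
Import numFieldNormedType.Exports.
Local Open Scope classical_set_scope.
Local Open Scope ring_scope.

Lemma sum_tuple_cons (R : nmodType) (T : finType) (n : nat)
    (F : n.+1.-tuple T -> R) :
  \sum_(s : n.+1.-tuple T) F s
    = \sum_(k : T) \sum_(s : n.-tuple T) F [tuple of k :: s].
Proof.
rewrite pair_bigA.
rewrite (reindex (fun p : T * n.-tuple T => [tuple of p.1 :: p.2])) //=.
exists (fun s : n.+1.-tuple T => (thead s, [tuple of behead s])).
  move=> [k s] _.
  by rewrite theadE; congr pair; apply: val_inj.
by move=> s _; rewrite -tuple_eta.
Qed.

(** * Discounted series of bounded real sequences *)

Section DiscountedSeries.
Context {R : realType}.
Variable beta : R.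
Hypotheses (beta_gt0 : 0 < beta) (beta_lt1 : beta < 1).

Definition discount (a : nat -> R) : R :=
  limn (series (fun t => beta ^+ t * a t)).

Definition ubounded (a : nat -> R) := exists M, forall t, `|a t| <= M.

Lemma norm_beta_lt1 : `|beta| < 1.
Proof. by rewrite gtr0_norm. Qed.

Lemma is_cvg_discount (a : nat -> R) : ubounded a ->
  cvgn (series (fun t => beta ^+ t * a t)).
Proof.
move=> [M aM]; apply: normed_cvg.
apply: (@series_le_cvg _ _ (geometric M beta)) => [n|n|n|].
- exact: normr_ge0.
- by apply: geometric_ge0; [exact: le_trans (aM n)|exact: ltW].
- rewrite /= normrM normrX (gtr0_norm beta_gt0) mulrC.
  by rewrite ler_wpM2r // exprn_ge0 // ltW.
- exact: is_cvg_geometric_series norm_beta_lt1.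
Qed.

(** Termwise comparison with the geometric series of first term [M] and ratio [beta]. *)
Lemma norm_discount_le (a : nat -> R) (M : R) : (forall t, `|a t| <= M) ->
  `|discount a| <= M / (1 - beta).
Proof.
move=> aM; have ca : cvgn (series (fun t => beta ^+ t * a t)).
  by apply: is_cvg_discount; exists M.
have cg := @is_cvg_geometric_series _ M _ norm_beta_lt1.
have lg : limn (series (geometric M beta)) = M / (1 - beta).
  by apply: cvg_lim => //; exact: cvg_geometric_series norm_beta_lt1.
have key n : `|beta ^+ n * a n| <= geometric M beta n.
  rewrite /= normrM normrX (gtr0_norm beta_gt0) mulrC.
  by rewrite ler_wpM2r // exprn_ge0 // ltW.
rewrite -lg ler_norml /discount; apply/andP; split.
  rewrite -limN //; apply: ler_lim => //; first exact: is_cvgN.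
  near=> n; rewrite fctE /series /= -sumrN; apply: ler_sum => i _.
  by have := key i; rewrite ler_norml => /andP[].
apply: ler_lim => //; near=> n; apply: ler_sum => i _.
by have := key i; rewrite ler_norml => /andP[].
Unshelve. all: by end_near. Qed.

Lemma discountD (a b : nat -> R) : ubounded a -> ubounded b ->
  discount (fun t => a t + b t) = discount a + discount b.
Proof.
move=> ba bb; rewrite /discount -limD; try exact: is_cvg_discount.
congr (limn _); apply/funext => n; rewrite fctE /series /= -big_split /=.
by apply: eq_bigr => i _; rewrite mulrDr.
Qed.

Lemma discountZ c (a : nat -> R) : ubounded a ->
  discount (fun t => c * a t) = c * discount a.
Proof.
move=> ba; have h := is_cvg_discount ba.
rewrite /discount (_ : series _ = c \*: series (fun t => beta ^+ t * a t)).
  exact: limZl_tmp.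
apply/funext => n; rewrite /series /= scaler_sumr.
by apply: eq_bigr => i _; rewrite mulrCA.
Qed.

Lemma discount_sum (I : finType) (c : I -> R) (a : I -> nat -> R) :
  (forall i, ubounded (a i)) ->
  discount (fun t => \sum_i c i * a i t) = \sum_i c i * discount (a i).
Proof.
move=> ba.
(* Boundedness is carried through the induction because [discountD] requires it of both summands. *)
suff key (s : seq I) : ubounded (fun t => \sum_(i <- s) c i * a i t) /\
    discount (fun t => \sum_(i <- s) c i * a i t)
      = \sum_(i <- s) c i * discount (a i) by have [] := key (index_enum I).
elim: s => [|i s [bs IH]].
  split; first by exists 0 => t; rewrite big_nil normr0.
  rewrite big_nil /discount (_ : series _ = cst 0) ?lim_cst //.
  apply/funext => n; rewrite /series /= big1 // => i _.
  by rewrite big_nil mulr0.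
have bi : ubounded (fun t => c i * a i t).
  have [M aM] := ba i; exists (`|c i| * M) => t.
  by rewrite normrM ler_wpM2l.
under eq_fun do rewrite big_cons.
rewrite discountD // discountZ // IH big_cons; split => //.
have [[M1 h1] [M2 h2]] := (bi, bs); exists (M1 + M2) => t.
by rewrite (le_trans (ler_normD _ _)) ?lerD.
Qed.

(** Source of every one-step recursion below: the tail of the series is again a discounted series,
    scaled by [beta]. *)
Lemma discountS (a : nat -> R) : ubounded a ->
  discount a = a 0%N + beta * discount (fun t => a t.+1).
Proof.
move=> ba; have ba' : ubounded (fun t => a t.+1).
  by have [M aM] := ba; exists M => t.
rewrite -discountZ // {1}/discount; apply: cvg_lim => //.
rewrite -cvg_shiftS /=.
rewrite (_ : (fun _ => _) = cst (a 0%N) \+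
    series (fun t => beta ^+ t * (beta * a t.+1))); last first.
  apply/funext => n; rewrite /series /= big_nat_recl //= expr0 mul1r.
  by congr (_ + _); apply: eq_bigr => i _; rewrite exprSr mulrA.
apply: cvgD; first exact: cvg_cst.
apply: is_cvg_discount; have [M aM] := ba'; exists (beta * M) => t.
by rewrite normrM (gtr0_norm beta_gt0) ler_wpM2l // ltW.
Qed.

End DiscountedSeries.

Definition shift_policy (R : realType) (K : nat) (pi : policy R K) :
  policy R K := fun t => pi t.+1.

(** Fixed by [shift_policy] up to conversion, so the one-step recursion for such a policy refers
    only to that policy. *)
Definition stationary (R : realType) (K : nat) (g : 'rV[R]_K -> bool) :
  policy R K := fun _ => g.

(** * Expected reward at a fixed time *)

Section Expectation.
Context {R : realType} {K : nat}.
Variable P : 'M[R]_K.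
Hypothesis P_stochastic : stochastic P.

Lemma simplex_row k : simplex (row k P).
Proof. exact: P_stochastic. Qed.

Lemma simplex_mulmx (w : 'rV[R]_K) : simplex w -> simplex (w *m P).
Proof.
move=> [w0 w1]; split => [k|].
  rewrite mxE sumr_ge0 // => i _; rewrite mulr_ge0 //.
  by have [/(_ k)] := P_stochastic i; rewrite mxE.
under eq_bigr do rewrite mxE.
rewrite exchange_big /= -w1; apply: eq_bigr => i _.
rewrite -mulr_sumr -[RHS]mulr1; congr (_ * _).
by have [_ <-] := P_stochastic i; apply: eq_bigr => j _; rewrite mxE.
Qed.

Lemma simplex_mean_le (w : 'rV[R]_K) (f : 'I_K -> R) c : simplex w ->
  (forall k, f k <= c) -> \sum_k w 0 k * f k <= c.
Proof.
move=> [w0 w1] fc; rewrite -[leRHS]mul1r -w1 mulr_suml.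
by apply: ler_sum => k _; rewrite ler_wpM2l.
Qed.

Lemma simplex_mean_ge (w : 'rV[R]_K) (f : 'I_K -> R) c : simplex w ->
  (forall k, c <= f k) -> c <= \sum_k w 0 k * f k.
Proof.
move=> [w0 w1] fc; rewrite -[leLHS]mul1r -[X in X * _]w1 mulr_suml.
by apply: ler_sum => k _; rewrite ler_wpM2l.
Qed.

Lemma norm_simplex_mean_le (w : 'rV[R]_K) (f : 'I_K -> R) c : simplex w ->
  (forall k, `|f k| <= c) -> `|\sum_k w 0 k * f k| <= c.
Proof.
move=> sw fc; rewrite (le_trans (ler_norm_sum _ _ _)) //.
rewrite (eq_bigr (fun k => w 0 k * `|f k|)) => [|k _].
  exact: simplex_mean_le.
by rewrite normrM ger0_norm //; case: sw.
Qed.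

(** An unobserved transition mixes the path laws started from the rows of [P]. On the empty path the
    two sides are 1 and the total mass of [w], hence the side condition. *)
Lemma path_prob_mulmx (w : 'rV[R]_K) (s : seq 'I_K) : s != [::] ->
  path_prob P (w *m P) s = \sum_k w 0 k * path_prob P (row k P) s.
Proof.
case: s => // j s _ /=; rewrite mxE mulr_suml.
by apply: eq_bigr => k _; rewrite mxE mulrA.
Qed.

Lemma belief_from_shift (pi : policy R K) t (w : 'rV[R]_K) (s : seq 'I_K) :
  belief_from P pi t.+1 w s = belief_from P (shift_policy pi) t w s.
Proof. by elim: s t w => //= k s IH t w; rewrite IH. Qed.

Definition mean_reward (B : 'rV[R]_K) (m : R) (pi : policy R K) (w : 'rV[R]_K)
  (t : nat) : R := expect P w (@reward R K P B pi w m t).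

Lemma total_rewardE (B : 'rV[R]_K) (beta m : R) (pi : policy R K)
    (w : 'rV[R]_K) :
  total_reward P B beta w m pi = discount beta (mean_reward B m pi w).
Proof. by []. Qed.

Lemma reward_cons (B : 'rV[R]_K) (pi : policy R K) (w : 'rV[R]_K) (m : R) t
    (k : 'I_K) (s : t.+1.-tuple 'I_K) :
  reward P B pi w m [tuple of k :: s]
    = reward P B (shift_policy pi) (if pi 0%N w then row k P else w *m P) m s.
Proof.
rewrite /reward /action /= belief_from_shift.
congr (if _ then B 0 _ else _).
by rewrite !(tnth_nth k).
Qed.

Lemma mean_reward0 (B : 'rV[R]_K) (m : R) (pi : policy R K) (w : 'rV[R]_K) :
  simplex w -> mean_reward B m pi w 0
    = if pi 0%N w then (w *m B^T) 0 0 else m.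
Proof.
move=> [w0 w1]; rewrite /mean_reward /expect sum_tuple_cons /=.
under eq_bigr => k _.
  rewrite (big_pred1 [tuple]) => [|s]; last by rewrite [s]tuple0 /= eqxx.
  rewrite /= mulr1 /reward /action /= (_ : tnth _ _ = k) //.
  over.
case: ifP => _; last by rewrite -mulr_suml w1 mul1r.
by rewrite mxE; apply: eq_bigr => k _; rewrite mxE.
Qed.

(** Condition on the first state. After a passive action the next belief does not depend on that
    state, so the sum over it acts on path probabilities alone and [path_prob_mulmx] applies. *)
Lemma mean_rewardS (B : 'rV[R]_K) (m : R) (pi : policy R K) (w : 'rV[R]_K) t :
  mean_reward B m pi w t.+1
    = if pi 0%N w
      then \sum_k w 0 k * mean_reward B m (shift_policy pi) (row k P) t
      else mean_reward B m (shift_policy pi) (w *m P) t.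
Proof.
rewrite /mean_reward /expect sum_tuple_cons.
under eq_bigr => k _ do under eq_bigr => s _ do rewrite reward_cons /= -mulrA.
case: ifP => _; first by apply: eq_bigr => k _; rewrite mulr_sumr.
rewrite exchange_big; apply: eq_bigr => s _ /=.
rewrite path_prob_mulmx; last by case: s => -[].
by rewrite mulr_suml; apply: eq_bigr => k _; rewrite mulrA.
Qed.

Lemma norm_mean_reward_le (B : 'rV[R]_K) (m M : R) (pi : policy R K)
    (w : 'rV[R]_K) t : simplex w -> (forall k, `|B 0 k| <= M) -> `|m| <= M ->
  `|mean_reward B m pi w t| <= M.
Proof.
move=> sw BM mM; elim: t => [|t IH] in pi w sw *.
  rewrite mean_reward0 //; case: ifP => // _.
  rewrite mxE; under eq_bigr do rewrite mxE.
  exact: norm_simplex_mean_le.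
rewrite mean_rewardS; case: ifP => _.
  by apply: norm_simplex_mean_le => // k; apply: IH; exact: simplex_row.
by apply: IH; exact: simplex_mulmx.
Qed.

(** Holds path by path: the indicator of passivity is the reward of an arm with zero rewards and
    subsidy 1. *)
Lemma mean_rewardD (B : 'rV[R]_K) (m : R) (pi : policy R K) (w : 'rV[R]_K) t :
  mean_reward B m pi w t
    = mean_reward B 0 pi w t + m * mean_reward 0 1 pi w t.
Proof.
rewrite /mean_reward /expect mulr_sumr -big_split /=.
apply: eq_bigr => s _; rewrite mulrCA -mulrDr; congr (_ * _).
by rewrite /reward; case: ifP => _; rewrite ?mxE ?mulr0 ?addr0 ?mulr1 ?add0r.
Qed.

Lemma reward_bound (B : 'rV[R]_K) (m : R) :
  exists2 M, forall k, `|B 0 k| <= M & `|m| <= M.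
Proof.
exists (`|m| + \sum_k `|B 0 k|) => [k|]; last by rewrite lerDl sumr_ge0.
by rewrite (bigD1 k) //= addrCA lerDl addr_ge0 // sumr_ge0.
Qed.

Lemma ubounded_mean_reward (B : 'rV[R]_K) (m : R) (pi : policy R K)
  (w : 'rV[R]_K) : simplex w -> ubounded (mean_reward B m pi w).
Proof.
move=> sw; have [M BM mM] := reward_bound B m.
by exists M => t; exact: norm_mean_reward_le.
Qed.

End Expectation.

(** * Total discounted reward of a fixed policy *)

Section TotalReward.
Context {R : realType} {K : nat}.
Variables (P : 'M[R]_K) (beta : R).
Hypotheses (P_stochastic : stochastic P).
Hypotheses (beta_gt0 : 0 < beta) (beta_lt1 : beta < 1).
Implicit Types (B w : 'rV[R]_K) (m M : R) (pi : policy R K).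

Let simplex_row := simplex_row P_stochastic.
Let simplex_mulmx := simplex_mulmx P_stochastic.

Lemma norm_total_reward_le B m M pi w : simplex w ->
  (forall k, `|B 0 k| <= M) -> `|m| <= M ->
  `|total_reward P B beta w m pi| <= M / (1 - beta).
Proof.
move=> sw BM mM; rewrite total_rewardE.
by apply: norm_discount_le => // t; exact: norm_mean_reward_le.
Qed.

Lemma total_reward_rec B m pi w : simplex w ->
  total_reward P B beta w m pi
    = if pi 0%N w then (w *m B^T) 0 0 + beta * \sum_k w 0 k *
             total_reward P B beta (row k P) m (shift_policy pi)
      else m + beta * total_reward P B beta (w *m P) m (shift_policy pi).
Proof.
move=> sw; have ub v pi' := @ubounded_mean_reward _ _ _ P_stochastic B m pi' v.
rewrite !total_rewardE discountS ?mean_reward0; [|by []..|exact: ub].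
under eq_fun do rewrite mean_rewardS.
case: ifP => _ //; congr (_ + _ * _).
by rewrite discount_sum // => k; exact/ub/simplex_row.
Qed.

(** Makes every result on total rewards, including comparison with stationary policies, available
    for passive times. *)
Lemma passive_timeE pi w :
  passive_time P beta w pi = total_reward P 0 beta w 1 pi.
Proof.
rewrite /passive_time /total_reward; congr (discounted _ _ _ _).
apply: functional_extensionality_dep => t; apply/funext => s.
rewrite /reward mxE.
by case: (action _ _ _).
Qed.

Lemma total_reward_affine B m pi w : simplex w ->
  total_reward P B beta w m pi
    = total_reward P B beta w 0 pi + m * passive_time P beta w pi.
Proof.
move=> sw; rewrite passive_timeE !total_rewardE.
have ub B' m' := @ubounded_mean_reward _ _ _ P_stochastic B' m' pi _ sw.
rewrite -discountZ // -discountD //; last first.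
  have [M hM] := ub 0 1; exists (`|m| * M) => t.
  by rewrite normrM ler_wpM2l.
by congr (discount _); apply/funext => t; exact: mean_rewardD.
Qed.

Lemma norm_passive_time_le pi w : simplex w ->
  `|passive_time P beta w pi| <= 1 / (1 - beta).
Proof.
move=> sw; rewrite passive_timeE; apply: norm_total_reward_le => //.
  by move=> k; rewrite mxE normr0.
by rewrite normr1.
Qed.

(** The supremum [c] of [u] over the simplex satisfies [c <= beta * c], hence [c <= 0]. The bound
    [M] serves only to make this supremum finite. *)
Lemma contraction_le0 (u : 'rV[R]_K -> R) M :
  (forall w, simplex w -> u w <= M) ->
  (forall c, (forall w, simplex w -> u w <= c) ->
     forall w, simplex w -> u w <= beta * c) ->
  forall w, simplex w -> u w <= 0.
Proof.
move=> uM uc w sw.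
set c := sup (u @` @simplex R K).
have hs : has_sup (u @` @simplex R K).
  by split; [exists (u w); exists w|exists M => _ [v sv <-]; exact: uM].
have h v : simplex v -> u v <= c.
  by move=> sv; apply: ub_le_sup; [case: hs|exists v].
have cc : c <= beta * c.
  by apply: ge_sup => [|_ [v sv <-]]; [case: hs|exact: uc].
apply: le_trans (h _ sw) _.
rewrite -(pmulr_rle0 _ (_ : 0 < 1 - beta)) ?subr_gt0 //.
by rewrite mulrBl mul1r subr_le0.
Qed.

End TotalReward.

(** * Bellman's equation and optimality of greedy policies *)

Section Value.
Context {R : realType} {K : nat}.
Variables (P : 'M[R]_K) (beta : R).
Hypotheses (P_stochastic : stochastic P).
Hypotheses (beta_gt0 : 0 < beta) (beta_lt1 : beta < 1).
Implicit Types (B w : 'rV[R]_K) (m : R) (pi : policy R K).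

Let simplex_row := simplex_row P_stochastic.
Let simplex_mulmx := simplex_mulmx P_stochastic.

(* Stated with an inequality because the supremum over policies is at first only
   known to satisfy one half of Bellman's equation: the policies that are good
   after the different observations may prescribe different actions in the same
   belief and cannot simply be glued together. *)
Lemma stationary_reward_ge B m (g : 'rV[R]_K -> bool) (u : 'rV[R]_K -> R) M :
  (forall w, simplex w -> u w <= M) ->
  (forall w, simplex w ->
     u w <= if g w then (w *m B^T) 0 0 + beta * \sum_k w 0 k * u (row k P)
            else m + beta * u (w *m P)) ->
  forall w, simplex w -> u w <= total_reward P B beta w m (stationary g).
Proof.
move=> uM ug w sw; rewrite -subr_le0; move: w sw.
have [N BN mN] := reward_bound B m.
(* In the difference between [u] and the reward of [g], the immediate rewards cancel after one step,
   leaving [beta] times an average of the same difference. *)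
apply: (contraction_le0 beta_lt1
  (u := fun w => u w - total_reward P B beta w m (stationary g))
  (M := M + N / (1 - beta))) => // [w sw|c uc w sw].
  rewrite lerD ?uM //; apply: (le_trans (ler_norm _)).
  by rewrite normrN; exact: norm_total_reward_le.
rewrite (total_reward_rec P_stochastic beta_gt0 beta_lt1) //.
rewrite lerBlDr (le_trans (ug _ sw)) //.
rewrite -[stationary g 0%N w]/(g w); case: ifP => _.
  rewrite addrCA lerD2l -mulrDr ler_pM2l // -lerBlDr -sumrB.
  under eq_bigr do rewrite -mulrBr.
  by apply: simplex_mean_le => // k; exact/uc/simplex_row.
rewrite addrCA lerD2l -mulrDr ler_pM2l // -lerBlDr.
exact/uc/simplex_mulmx.
Qed.

(** [sup] is an upper bound only of a bounded set; the bound on total rewards uniform in the policy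
    supplies this. *)
Lemma total_reward_le_value B m pi w : simplex w ->
  total_reward P B beta w m pi <= value P B beta w m.
Proof.
move=> sw; have [M BM mM] := reward_bound B m.
apply: ub_le_sup; last by exists pi.
exists (M / (1 - beta)) => _ [pi' _ <-].
by rewrite (le_trans (ler_norm _)) // norm_total_reward_le.
Qed.

Lemma value_le B m w c : (forall pi, total_reward P B beta w m pi <= c) ->
  value P B beta w m <= c.
Proof.
move=> h; apply: ge_sup => [|_ [pi _ <-]] //.
by exists (total_reward P B beta w m (fun _ _ => true)), (fun _ _ => true).
Qed.

(** The easy half of Bellman's equation: what follows the first action is itself a policy, worth at
    most the value of the next belief. *)
Lemma value_le_max B m w : simplex w ->
  value P B beta w m
    <= Num.max (value_active P B beta w m) (value_passive P B beta w m).
Proof.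
move=> sw; apply: value_le => pi.
rewrite (total_reward_rec P_stochastic beta_gt0 beta_lt1) // le_max.
case: ifP => _; apply/orP; [left|right]; rewrite lerD2l ler_pM2l //.
  apply: ler_sum => k _; rewrite ler_wpM2l //; first by case: sw.
  exact/total_reward_le_value/simplex_row.
exact/total_reward_le_value/simplex_mulmx.
Qed.

(** Both actions are allowed at a tie; this freedom is used later to select a policy with the
    largest passive time. *)
Definition greedy B m (g : 'rV[R]_K -> bool) := forall w, simplex w ->
  if g w then value_passive P B beta w m <= value_active P B beta w m
  else value_active P B beta w m <= value_passive P B beta w m.

(** By [value_le_max] the value is at most its update under the action of [g], so
    [stationary_reward_ge] applies with the value as [u]. *)
Lemma greedy_optimal B m g w : greedy B m g -> simplex w ->
  total_reward P B beta w m (stationary g) = value P B beta w m.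
Proof.
move=> gg sw; apply/le_anti/andP; split; first exact: total_reward_le_value.
have [M BM mM] := reward_bound B m; move: w sw.
apply: (@stationary_reward_ge B m g (fun v => value P B beta v m)
  (M / (1 - beta))) => v sv.
  apply: value_le => pi.
  by rewrite (le_trans (ler_norm _)) // norm_total_reward_le.
have := gg v sv; have := value_le_max B m sv.
rewrite -/(value_active P B beta v m) -/(value_passive P B beta v m).
by case: ifP => _ h le; rewrite (le_trans h) // ge_max lexx ?andbT.
Qed.

Lemma greedy_exists B m : exists g, greedy B m g.
Proof.
exists (fun w => value_passive P B beta w m <= value_active P B beta w m).
by move=> w _; case: leP => // /ltW.
Qed.

(** For the missing half, the one-step recursion of a greedy policy has the value on both sides and
    the larger branch on the right. *)
Lemma value_bellman B m w : simplex w ->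
  value P B beta w m
    = Num.max (value_active P B beta w m) (value_passive P B beta w m).
Proof.
move=> sw; have [g gg] := greedy_exists B m.
apply/le_anti/andP; split; first exact: value_le_max.
rewrite -(greedy_optimal gg sw).
rewrite (total_reward_rec P_stochastic beta_gt0 beta_lt1) //.
rewrite -[stationary g 0%N w]/(g w).
under eq_bigr => k _ do rewrite (greedy_optimal gg (simplex_row k)).
rewrite (greedy_optimal gg (simplex_mulmx sw)).
have := gg w sw; rewrite -/(value_active P B beta w m).
rewrite -/(value_passive P B beta w m).
by case: ifP => _ h; rewrite ge_max lexx h.
Qed.

Lemma value_subgradient B m w pi m' : simplex w ->
  optimal_policies P B beta w m pi ->
  value P B beta w m + (m' - m) * passive_time P beta w pi
    <= value P B beta w m'.
Proof.
move=> sw <-; apply: le_trans (total_reward_le_value B m' pi sw).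
have aff := total_reward_affine P_stochastic beta_gt0 beta_lt1 B _ pi sw.
by rewrite (aff m) (aff m') mulrBl addrAC addrA subrK addrC.
Qed.

(** Supporting lines of uniformly bounded slope are the form in which convexity and Lipschitz
    continuity in [m] are used below. *)
Lemma value_has_subgradient B w : simplex w -> forall m,
  exists2 d : R, `|d| <= 1 / (1 - beta) &
    forall m', value P B beta w m + (m' - m) * d <= value P B beta w m'.
Proof.
move=> sw m; have [g gg] := greedy_exists B m.
exists (passive_time P beta w (stationary g)) => [|m'].
  exact: norm_passive_time_le.
by apply: value_subgradient => //; exact: greedy_optimal.
Qed.

End Value.

(** * Right derivatives of functions with supporting lines, and of maxima *)

Section RightDerivative.
Context {R : realType}.
Implicit Types f : R -> R.

Lemma right_quotientK f x h : h != 0 ->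
  f (x + h) = f x + h * right_quotient f x h.
Proof. by move=> h0; rewrite /right_quotient mulrA divff // mul1r subrKC. Qed.

Lemma cvg_right_derivable f x : right_derivable f x ->
  f (x + h) @[h --> 0^'+] --> f x.
Proof.
move=> df.
have cvgf : f x + h * right_quotient f x h @[h --> 0^'+]
    --> f x + 0 * right_derivative f x.
  apply: cvgD; first exact: cvg_cst.
  apply: cvgM => //; apply: cvg_at_right_filter; exact: cvg_id.
rewrite mul0r addr0 in cvgf; apply: (cvg_trans _ cvgf).
apply: near_eq_cvg; near=> h.
by rewrite -right_quotientK // gt_eqF //; near: h; exact: nbhs_right_gt.
Unshelve. all: by end_near. Qed.

Section Subgradient.
Variables (f : R -> R) (L : R).
Hypothesis f_subgradient : forall x, exists2 d : R, `|d| <= L &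
  forall y, f x + (y - x) * d <= f y.

Lemma subgradient_lipschitz x y : `|f x - f y| <= L * `|x - y|.
Proof.
(* The supporting line at [u] bounds this difference; exchanging the points gives the other sign. *)
have key u v : f u - f v <= L * `|u - v|.
  have [d dL /(_ v) h] := f_subgradient u.
  have : (u - v) * d <= L * `|u - v|.
    rewrite (le_trans (ler_norm _)) // normrM mulrC.
    by rewrite ler_wpM2r.
  by apply: le_trans; nra.
by rewrite ler_norml key andbT lerNl opprB (distrC x).
Qed.

Lemma subgradient_right_quotient x d h : 0 < h ->
  (forall y, f x + (y - x) * d <= f y) -> d <= right_quotient f x h.
Proof.
move=> h0 /(_ (x + h)) hd; rewrite /right_quotient ler_pdivlMl //; nra.
Qed.

(** The right quotients are nondecreasing in [h] and bounded below by any subgradient at [x]. *)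
Lemma subgradient_right_derivable x : right_derivable f x.
Proof.
apply: nondecreasing_at_right_is_cvgr.
  near=> z => h h' /[!in_itv]/= /andP[h0 _] /andP[h'0 _] hh'.
  (* The line supporting [f] at [x + h] is compared with [f] at [x] and at [x + h']; with weights
     [h' - h] and [h] its slope cancels. *)
  have [d _ fd] := f_subgradient (x + h).
  rewrite /right_quotient ler_pdivlMl // mulrCA ler_pdivrMl //.
  have := fd x; have := fd (x + h'); nra.
near=> z; have [d dL fd] := f_subgradient x.
exists d => _ [h /= /[!in_itv]/= /andP[h0 _] <-].
exact: subgradient_right_quotient.
Unshelve. all: by end_near. Qed.

End Subgradient.

Lemma right_derivative_max_le f f1 f2 x :
  right_derivable f x -> right_derivable f1 x -> right_derivable f2 x ->
  (forall y, f y = Num.max (f1 y) (f2 y)) -> f2 x <= f1 x ->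
  (f2 x = f1 x -> right_derivative f2 x <= right_derivative f1 x) ->
  right_derivative f x <= right_derivative f1 x.
Proof.
move=> df df1 df2 fE; rewrite le_eqVlt => /predU1P[e|lt21] d21; last first.
  have fx : f x = f1 x by rewrite fE max_l // ltW.
  apply: ler_lim => //; near=> h.
  have h0 : 0 < h by near: h; exact: nbhs_right_gt.
  rewrite /right_quotient fx ler_pM2l ?invr_gt0 // lerD2r fE ge_max lexx /=.
  (* The midpoint separates [f2] from [f1] just to the right of [x], by right continuity, so [f]
     coincides with [f1] there. *)
  apply: (@le_trans _ _ ((f1 x + f2 x) / 2)); apply: ltW.
    near: h; apply: (cvgr_lt _ (cvg_right_derivable df2)); lra.
  near: h; apply: (cvgr_gt _ (cvg_right_derivable df1)); lra.
(* At a tie, a larger right derivative of [f] would put its quotient strictly above those of both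
   branches for small [h], although [f (x + h)] is the value of one of them. *)
rewrite leNgt; apply/negP => lt1; have lt2 := le_lt_trans (d21 e) lt1.
have c : right_quotient f x h @[h --> 0^'+] --> right_derivative f x := df.
have c1 : right_quotient f1 x h @[h --> 0^'+] --> right_derivative f1 x := df1.
have c2 : right_quotient f2 x h @[h --> 0^'+] --> right_derivative f2 x := df2.
suff : \forall h \near (0 : R)^'+, False by case/filter_ex.
near=> h.
have h0 : 0 < h by near: h; exact: nbhs_right_gt.
have q1 : right_quotient f1 x h < right_quotient f x h.
  apply: (@lt_trans _ _ ((right_derivative f1 x + right_derivative f x) / 2)).
    near: h; apply: (cvgr_lt _ c1); lra.
  near: h; apply: (cvgr_gt _ c); lra.
have q2 : right_quotient f2 x h < right_quotient f x h.
  apply: (@lt_trans _ _ ((right_derivative f2 x + right_derivative f x) / 2)).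
    near: h; apply: (cvgr_lt _ c2); lra.
  near: h; apply: (cvgr_gt _ c); lra.
have fx : f x = f1 x by rewrite fE e maxxx.
move: q1 q2; rewrite /right_quotient !ltr_pM2l ?invr_gt0 // e fx.
rewrite !ltrD2r fE /Num.max; case: ifP => _; rewrite ltxx //.
Unshelve. all: by end_near. Qed.

End RightDerivative.

(* Apply the hypothesis at the last point where f is nonnegative. *)
Lemma nonneg_persists (R : realType) (f : R -> R) (C : R) : 0 < C ->
  (forall x y, `|f x - f y| <= C * `|x - y|) ->
  (forall x, f x = 0 ->
     exists2 d, 0 < d & forall y, x < y < x + d -> 0 <= f y) ->
  forall x y, x <= y -> 0 <= f x -> 0 <= f y.
Proof.
move=> C0 flip f0 x y xy fx; rewrite leNgt; apply/negP => fy.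
have dist u v : u <= v -> `|f u - f v| <= C * (v - u).
  by move=> uv; rewrite (le_trans (flip u v)) // distrC ger0_norm ?subr_ge0.
set S := [set t | [/\ x <= t, t <= y & 0 <= f t]].
have hS : has_sup S.
  by split; [exists x; split|exists y => t [_ ty _]].
set s := sup S.
have le_s t : S t -> t <= s by move=> St; apply: ub_le_sup; [case: hS|].
have sy : s <= y by apply: ge_sup; [case: hS|move=> t [_ ty _]].
have xs : x <= s by apply: le_s; split.
have fs : 0 <= f s.
  (* If [f s] were negative, [f] would stay negative within distance [- f s / C] to the left of [s],
     where the supremum guarantees a point of [S]. *)
  rewrite leNgt; apply/negP => fs.
  have e0 : 0 < - f s / C by rewrite divr_gt0 // oppr_gt0.
  have [t St] := sup_adherent e0 hS; rewrite -/s => st.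
  have := dist t s (le_s t St); case: St => _ _ ft.
  rewrite ler_norml => /andP[_]; apply/negP; rewrite -ltNge.
  have : C * (s - t) < - f s by rewrite mulrC -ltr_pdivlMr //; lra.
  lra.
have lt_sy : s < y.
  by rewrite lt_neqAle sy andbT; apply: contraTneq fs => ->; rewrite -ltNge.
(* At a zero this is the hypothesis; at a positive value the Lipschitz bound gives the length
   [f s / C]. *)
have [d d0 fd] : exists2 d, 0 < d & forall t, s < t < s + d -> 0 <= f t.
  have [/f0//|fs0] := eqVneq (f s) 0.
  have {}fs : 0 < f s by rewrite lt_neqAle eq_sym fs0.
  exists (f s / C) => [|t /andP[st td]]; first by rewrite divr_gt0.
  have := dist s t (ltW st); rewrite ler_norml => /andP[_].
  have : C * (t - s) < f s by rewrite mulrC -ltr_pdivlMr //; lra.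
  lra.
(* A point of [S] beyond its supremum: the halves keep [t] below both [y] and [s + d]. *)
pose t := s + Num.min ((y - s) / 2) (d / 2).
have m1 : Num.min ((y - s) / 2) (d / 2) <= (y - s) / 2 by rewrite ge_min lexx.
have m2 : Num.min ((y - s) / 2) (d / 2) <= d / 2 by rewrite ge_min lexx orbT.
have m0 : 0 < Num.min ((y - s) / 2) (d / 2).
  by rewrite lt_min; apply/andP; split; lra.
have : t <= s.
  apply: le_s; split; rewrite /t; [lra|lra|apply: fd; apply/andP; split; lra].
rewrite /t; lra.
Qed.

(** * The right derivative of the value as the largest optimal passive time *)

Section Indexability.
Context {R : realType} {K : nat}.
Variables (P : 'M[R]_K) (B : 'rV[R]_K) (beta : R).
Hypotheses (P_stochastic : stochastic P).
Hypotheses (beta_gt0 : 0 < beta) (beta_lt1 : beta < 1).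
Implicit Types (w : 'rV[R]_K) (m M : R) (pi : policy R K).

Let simplex_row := simplex_row P_stochastic.
Let simplex_mulmx := simplex_mulmx P_stochastic.
Let V := value P B beta.
Let V1 := value_active P B beta.
Let V0 := value_passive P B beta.

Let V_subgradient w (sw : simplex w) :=
  value_has_subgradient P_stochastic beta_gt0 beta_lt1 B sw.

Lemma value_right_derivable w m : simplex w -> right_derivable (V w) m.
Proof. by move=> /V_subgradient/subgradient_right_derivable; apply. Qed.

(** Stated as a convergence in order to yield both right derivability and the derivative. *)
Lemma value_passive_right_derivative w m : simplex w ->
  right_quotient (V0 w) m h @[h --> 0^'+]
    --> 1 + beta * right_derivative (V (w *m P)) m.
Proof.
move=> sw.
have c : 1 + beta * right_quotient (V (w *m P)) m h @[h --> 0^'+]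
    --> 1 + beta * right_derivative (V (w *m P)) m.
  apply: cvgD; first exact: cvg_cst.
  apply: cvgM; first exact: cvg_cst.
  exact/value_right_derivable/simplex_mulmx.
(* The term [m] has quotient 1 only for [h != 0], since the inverse of 0 is 0; the equality is
   therefore claimed only near 0. *)
apply: (cvg_trans _ c); apply: near_eq_cvg; near=> h.
have h0 : h != 0 by rewrite gt_eqF //; near: h; exact: nbhs_right_gt.
rewrite /right_quotient /V0 /value_passive -/V; field.
exact: h0.
Unshelve. all: by end_near. Qed.

Lemma value_active_right_derivative w m : simplex w ->
  right_quotient (V1 w) m h @[h --> 0^'+]
    --> beta * \sum_k w 0 k * right_derivative (V (row k P)) m.
Proof.
move=> sw.
have -> : right_quotient (V1 w) m = fun h =>
    beta * \sum_k w 0 k * right_quotient (V (row k P)) m h.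
  apply/funext => h; rewrite /right_quotient /V1 /value_active -/V.
  rewrite opprD addrACA subrr add0r -mulrBr mulrCA -sumrB.
  congr (_ * _); rewrite mulr_sumr.
  by apply: eq_bigr => k _; rewrite -mulrBr mulrCA.
apply: cvgM; first exact: cvg_cst.
apply: cvg_big => [|k _]; first exact: add_continuous.
apply: cvgM; first exact: cvg_cst.
exact/value_right_derivable/simplex_row.
Qed.

(** Supplies the upper bound that [stationary_reward_ge] asks for when applied to right
    derivatives. *)
Lemma right_derivative_le_bound w m : simplex w ->
  right_derivative (V w) m <= 1 / (1 - beta).
Proof.
move=> sw; apply: limr_le; first exact: value_right_derivable.
near=> h; have h0 : 0 < h by near: h; exact: nbhs_right_gt.
rewrite /right_quotient ler_pdivrMl // mulrC.
rewrite (le_trans (ler_norm _)) //.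
have := subgradient_lipschitz (V_subgradient sw) (m + h) m.
by rewrite [m + h - m]addrAC subrr add0r (gtr0_norm h0).
Unshelve. all: by end_near. Qed.

Lemma passive_time_le_right_derivative w m pi : simplex w ->
  optimal_policies P B beta w m pi ->
  passive_time P beta w pi <= right_derivative (V w) m.
Proof.
move=> sw opi; apply: limr_ge; first exact: value_right_derivable.
near=> h; have h0 : 0 < h by near: h; exact: nbhs_right_gt.
apply: subgradient_right_quotient => // m'.
exact: value_subgradient.
Unshelve. all: by end_near. Qed.

Lemma right_derivative_attained w m : simplex w ->
  exists2 pi, optimal_policies P B beta w m pi &
    passive_time P beta w pi = right_derivative (V w) m.
Proof.
(* Optimal actions, ties being broken by the right derivative. Right derivatives
   of V then satisfy the evaluation equation of the passive time of g. *)
pose g v := (V0 v m < V1 v m) || (V0 v m == V1 v m) &&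
  (right_derivative (V0 v) m <= right_derivative (V1 v) m).
have gg : greedy P beta B m g.
  move=> v _; rewrite /g -/(V0 v m) -/(V1 v m).
  by case: ltgtP => //= _; case: ifP.
move=> sw; exists (stationary g); first exact: greedy_optimal.
apply/le_anti/andP; split.
  by apply: passive_time_le_right_derivative => //; exact: greedy_optimal.
(* Seen as a total reward with [B = 0] and subsidy 1, the passive time of [g] dominates the right
   derivative as soon as the latter is at most its one-step update under [g]. That update is the
   right derivative of the branch chosen by [g], and [right_derivative_max_le] concludes. *)
rewrite passive_timeE; move: w sw.
apply: (stationary_reward_ge P_stochastic beta_gt0 beta_lt1
  (u := fun v => right_derivative (V v) m) (M := 1 / (1 - beta))) => v sv.
  exact: right_derivative_le_bound.
have d1 := value_active_right_derivative (m := m) sv.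
have d0 := value_passive_right_derivative (m := m) sv.
have dV := value_right_derivable (m := m) sv.
have VE m' : V v m' = Num.max (V1 v m') (V0 v m') by exact: value_bellman.
rewrite trmx0 mulmx0 mxE add0r.
have <- : right_derivative (V1 v) m
  = beta * \sum_k v 0 k * right_derivative (V (row k P)) m.
  exact: cvg_lim.
have <- : right_derivative (V0 v) m
  = 1 + beta * right_derivative (V (v *m P)) m.
  exact: cvg_lim.
have := gg v sv; rewrite -/(V0 v m) -/(V1 v m).
rewrite /g; case: ltgtP => /= [h _|h _|h].
- apply: (right_derivative_max_le dV (cvgP _ d1) (cvgP _ d0) VE (ltW h)) => e.
  by rewrite e ltxx in h.
- apply: (right_derivative_max_le dV (cvgP _ d0) (cvgP _ d1) _ (ltW h)).
    by move=> m'; rewrite maxC.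
  by move=> e; rewrite e ltxx in h.
- have [d01 _|/ltW d10 _] := leP.
    apply: (right_derivative_max_le dV (cvgP _ d1) (cvgP _ d0) VE) => //.
    by rewrite h.
  apply: (right_derivative_max_le dV (cvgP _ d0) (cvgP _ d1)); rewrite ?h //.
  by move=> m'; rewrite maxC.
Qed.

Lemma max_passive_timeE w m : simplex w ->
  max_passive_time P B beta w m = right_derivative (V w) m.
Proof.
move=> sw; have [pi opi dpi] := right_derivative_attained m sw.
apply/le_anti/andP; split; last first.
  rewrite -dpi; apply: ub_le_sup; last by exists pi.
  exists (right_derivative (V w) m) => _ [pi' opi' <-].
  exact: passive_time_le_right_derivative.
apply: ge_sup => [|_ [pi' opi' <-]].
  by exists (passive_time P beta w pi), pi.
exact: passive_time_le_right_derivative.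
Qed.

(** * Bounds on the value and the passive set for extreme subsidies *)

Lemma discounted_constE (c : R) : c / (1 - beta) = c + beta * (c / (1 - beta)).
Proof. by field; rewrite subr_eq0 gt_eqF. Qed.

(** [M / (1 - beta)] is the worth of receiving [M] forever. The excess of the value over it shrinks
    by [beta] at each step, so [contraction_le0] applies. *)
Lemma value_le_bound M m w : (forall k, B 0 k <= M) -> m <= M -> simplex w ->
  V w m <= M / (1 - beta).
Proof.
move=> BM mM sw; rewrite -subr_le0; move: w sw.
have [N BN mN] := reward_bound B m.
apply: (contraction_le0 beta_lt1 (u := fun w => V w m - M / (1 - beta))
  (M := N / (1 - beta) - M / (1 - beta))) => [w sw|c uc w sw].
  rewrite lerD2r; apply: value_le => pi.
  by rewrite (le_trans (ler_norm _)) // norm_total_reward_le.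
have {}uc v : simplex v -> V v m <= c + M / (1 - beta).
  by move=> sv; rewrite -lerBlDr uc.
rewrite lerBlDr (le_trans (value_le_max P_stochastic _ _ _ _ sw)) //.
rewrite [M / _]discounted_constE addrCA -mulrDr.
rewrite ge_max; apply/andP; split; apply: lerD => //.
- rewrite mxE; under eq_bigr do rewrite mxE.
  exact: simplex_mean_le.
- by rewrite ler_pM2l //; apply: simplex_mean_le => // k; exact/uc/simplex_row.
- by rewrite ler_pM2l //; exact/uc/simplex_mulmx.
Qed.

Lemma value_ge_passive m w : simplex w -> m / (1 - beta) <= V w m.
Proof.
move=> sw; apply: le_trans (total_reward_le_value P_stochastic beta_gt0
  beta_lt1 B m (stationary (fun=> false)) sw).
move: w sw; apply: (stationary_reward_ge P_stochastic beta_gt0 beta_lt1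
  (u := fun=> m / (1 - beta)) (M := m / (1 - beta))) => // w sw.
by rewrite {1}discounted_constE.
Qed.

Lemma value_ge_active M m w : (forall k, M <= B 0 k) -> simplex w ->
  M / (1 - beta) <= V w m.
Proof.
move=> MB sw; apply: le_trans (total_reward_le_value P_stochastic beta_gt0
  beta_lt1 B m (stationary (fun=> true)) sw).
move: w sw; apply: (stationary_reward_ge P_stochastic beta_gt0 beta_lt1
  (u := fun=> M / (1 - beta)) (M := M / (1 - beta))) => // w sw.
rewrite {1}discounted_constE; apply: lerD.
  by rewrite mxE; under eq_bigr do rewrite mxE; exact: simplex_mean_ge.
by rewrite ler_pM2l //; exact: simplex_mean_ge.
Qed.

Lemma passive_set_near_ninfty :
  \forall m \near -oo, passive_set P B beta m = set0.
Proof.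
have [M BM] := reward_bound B 0; rewrite normr0 => M0.
near=> m; apply/seteqP; split => // w [sw].
rewrite leNgt => /negP; apply.
(* Passivity is worth at most [m + M / (1 - beta)] and activity at least [- (M / (1 - beta))]; this
   threshold separates them. *)
have mM : m < - (2 * (M / (1 - beta))).
  by near: m; apply: nbhs_ninfty_lt; exact: num_real.
have b0 : 0 < 1 - beta by rewrite subr_gt0.
have c0 : 0 <= M / (1 - beta) by rewrite divr_ge0 // ltW.
have {}BM k : - M <= B 0 k <= M by rewrite -ler_norml.
have up : value P B beta (w *m P) m <= M / (1 - beta).
  apply: value_le_bound; [|lra|exact: simplex_mulmx].
  by move=> k; case/andP: (BM k).
have lo : - (M / (1 - beta)) <= value_active P B beta w m.
  have low k : - M / (1 - beta) <= value P B beta (row k P) m.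
    by apply: value_ge_active; [move=> j; case/andP: (BM j)|exact: simplex_row].
  rewrite /value_active.
  rewrite -mulNr discounted_constE.
  apply: lerD; last by rewrite ler_pM2l //; exact: simplex_mean_ge.
  rewrite mxE; under eq_bigr do rewrite mxE.
  by apply: simplex_mean_ge => // k; case/andP: (BM k).
apply: lt_le_trans lo; rewrite /value_passive.
have : beta * value P B beta (w *m P) m <= M / (1 - beta).
  by rewrite (le_trans (ler_wpM2l (ltW beta_gt0) up)) // ler_piMl // ltW.
lra.
Unshelve. all: by end_near. Qed.

(** Once [m] dominates all rewards, the immediate terms compare directly, and [m / (1 - beta)] lies
    between the two continuation values. *)
Lemma passive_set_near_pinfty :
  \forall m \near +oo, passive_set P B beta m = @simplex R K.
Proof.
have [M BM] := reward_bound B 0; rewrite normr0 => M0.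
near=> m; apply/seteqP; split => w; first by case.
have mM : M <= m by near: m; apply: nbhs_pinfty_ge; exact: num_real.
have {}BM k : B 0 k <= m.
  by rewrite (le_trans (ler_norm _)) // (le_trans (BM k)).
move=> sw; split => //; apply: lerD.
  rewrite mxE; under eq_bigr do rewrite mxE.
  exact: simplex_mean_le.
rewrite ler_pM2l // (le_trans _ (value_ge_passive _ (simplex_mulmx sw))) //.
by apply: simplex_mean_le => // k; apply: value_le_bound.
Unshelve. all: by end_near. Qed.

(** * The sign of the advantage of passivity as the subsidy grows *)

Let gap w m := V0 w m - V1 w m.

(** The subsidy contributes 1 to the constant, and each of the two continuation values
    [1 / (1 - beta)], their factor [beta] being bounded by 1. *)
Lemma gap_lipschitz w m m' : simplex w ->
  `|gap w m - gap w m'| <= (1 + 2 / (1 - beta)) * `|m - m'|.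
Proof.
move=> sw; have lip v (sv : simplex v) :=
  subgradient_lipschitz (V_subgradient sv) m m'.
have -> : gap w m - gap w m' = (m - m')
    + beta * (V (w *m P) m - V (w *m P) m')
    - beta * \sum_k w 0 k * (V (row k P) m - V (row k P) m').
  rewrite /gap /V0 /V1 /value_passive /value_active -/V.
  under [in RHS]eq_bigr do rewrite mulrBr.
  by rewrite sumrB; ring.
have beta_le (x : R) : `|beta * x| <= `|x|.
  by rewrite normrM gtr0_norm // ler_piMl // ltW.
have h0 := le_trans (beta_le _) (lip _ (simplex_mulmx sw)).
have h1 := le_trans (beta_le _)
  (norm_simplex_mean_le sw (fun k => lip _ (simplex_row k))).
rewrite (le_trans (ler_normB _ _)) // (le_trans (lerD (ler_normD _ _) h1)) //.
apply: (le_trans (lerD (lerD (lexx _) h0) (lexx _))).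
by rewrite [leRHS](_ : _ = `|m - m'| + 1 / (1 - beta) * `|m - m'|
  + 1 / (1 - beta) * `|m - m'|) //; ring.
Qed.

Lemma gap_right_quotient_cvg w m : simplex w ->
  right_quotient (gap w) m h @[h --> 0^'+]
    --> right_derivative (V0 w) m - right_derivative (V1 w) m.
Proof.
move=> sw.
have c0 := cvgP _ (value_passive_right_derivative (m := m) sw).
have c1 := cvgP _ (value_active_right_derivative (m := m) sw).
have -> : right_quotient (gap w) m = fun h =>
    right_quotient (V0 w) m h - right_quotient (V1 w) m h.
  by apply/funext => h; rewrite /right_quotient /gap; ring.
exact: cvgB.
Qed.

Lemma indexableP :
  indexable P B beta <->
  forall w m, decision_boundary P B beta m w ->
    right_derivative (V1 w) m <= right_derivative (V0 w) m /\
    (right_derivative (V0 w) m = right_derivative (V1 w) m ->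
     exists2 dm, 0 < dm &
       forall m', m < m' < m + dm -> V1 w m' <= V0 w m').
Proof.
split=> [[mono _ _] w m [sw e]|cond].
  have pos m' : m <= m' -> V1 w m' <= V0 w m'.
    by move=> mm'; have [] := mono _ _ mm' w; first by split => //; rewrite e.
  (* Any positive length would do, since [pos] covers all [m'] to the right of [m]. *)
  split; last by exists 1 => // m' /andP[/ltW /pos].
  rewrite -subr_ge0.
  have c := gap_right_quotient_cvg (m := m) sw.
  rewrite -(cvg_lim _ c) //; apply: limr_ge; first exact: cvgP c.
  near=> h; have h0 : 0 < h by near: h; exact: nbhs_right_gt.
  rewrite /right_quotient mulr_ge0 ?invr_ge0 ?(ltW h0) //.
  have -> : gap w m = 0 by rewrite /gap /V1 e subrr.
  by rewrite subr0 subr_ge0; apply: pos; rewrite lerDl ltW.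
split; [|exact: passive_set_near_ninfty|exact: passive_set_near_pinfty].
move=> m1 m2 m12 w [sw]; rewrite -subr_ge0 => gap1; split => //.
rewrite -subr_ge0; move: m12 gap1.
apply: (@nonneg_persists _ (gap w) (1 + 2 / (1 - beta))) => [|x y|m gap0].
- by rewrite addr_gt0 // divr_gt0 // subr_gt0.
- exact: gap_lipschitz.
have e : V1 w m = V0 w m by apply/esym/eqP; rewrite -subr_eq0 -/(gap w m) gap0.
have [le10 tie] := cond w m (conj sw e).
have [/tie[d d0 dm]|ne] :=
  eqVneq (right_derivative (V0 w) m) (right_derivative (V1 w) m).
  by exists d => // y /dm; rewrite subr_ge0.
(* Without equality the gap has a positive right derivative at its zero [m], so it is positive just
   to the right. *)
have {ne}lt10 : 0 < right_derivative (V0 w) m - right_derivative (V1 w) m.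
  by rewrite subr_gt0 lt_neqAle eq_sym ne.
have [d /= d0 gap_pos] :=
  cvgr_gt _ (gap_right_quotient_cvg (m := m) sw) _ lt10.
exists d => // y /andP[my yd].
have h0 : 0 < y - m by rewrite subr_gt0.
have := gap_pos (y - m); rewrite /= sub0r normrN gtr0_norm // ltrBlDl.
move=> /(_ yd h0); rewrite /right_quotient subrKC gap0 subr0.
by rewrite pmulr_rgt0 ?invr_gt0 // => /ltW.
Unshelve. all: by end_near. Qed.

End Indexability.

Theorem theorem1 (R : realType) (K : nat) (P : 'M[R]_K) (B : 'rV[R]_K)
    (beta : R)
    (K_gt0 : (0 < K)%N)
    (P_stochastic : stochastic P)
    (P_irreducible : irreducible P)
    (P_aperiodic : aperiodic P)
    (B_first : forall k : 'I_K, nat_of_ord k = 0%N -> B 0 k = 0)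
    (B_nondecreasing : forall i j : 'I_K, (i <= j)%N -> B 0 i <= B 0 j)
    (beta_gt0 : 0 < beta) (beta_lt1 : beta < 1) :
  (forall w : 'rV[R]_K, simplex w -> forall m0 : R,
    [/\ (* the maximum defining the passive time is attained *)
        optimal_passive_times P B beta w m0 (max_passive_time P B beta w m0),
        right_derivable (value P B beta w) m0 &
        right_derivative (value P B beta w) m0
          = max_passive_time P B beta w m0]) /\
  (indexable P B beta <->
   forall (w : 'rV[R]_K) (m : R), decision_boundary P B beta m w ->
     right_derivative (value_active P B beta w) m
       <= right_derivative (value_passive P B beta w) m /\
     (right_derivative (value_passive P B beta w) m
        = right_derivative (value_active P B beta w) m ->
      exists2 dm : R, 0 < dm &
        forall m' : R, m < m' < m + dm ->
          value_active P B beta w m' <= value_passive P B beta w m')).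
Proof.
split; last exact: indexableP.
move=> w sw m; rewrite max_passive_timeE //; split => //.
  exact: right_derivative_attained.
exact: value_right_derivable.
Qed.
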